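(* Let $\alpha$ be a real number with $\sin(\alpha)=\frac{1}{\sqrt{3}}$. Then $$Cl_{2}(\alpha)+Cl_{2}(\pi-\alpha)+Cl_{2}\left(\frac{\pi}{3}-\alpha\right)-Cl_{2}\left(\frac{2\pi}{3}-\alpha\right)=\frac{7}{4}\,Cl_{2}\left(\frac{2\pi}{3}\right).$$
   Context: $Cl_2$ denotes the Clausen function on $\mathbb{R}$: $Cl_{2}(x)=-\int_{0}^{x}\log\left(2\left|\sin\frac{\varphi}{2}\right|\right)d\varphi=\sum_{n=1}^{\infty}\frac{\sin(nx)}{n^{2}}$. *)

(* Defs.v *)
From Stdlib Require Import Reals.
From Coquelicot Require Import Coquelicot.
Local Open Scope R_scope.

(* The sum of sin (n x) / n ^ 2 over n >= 1, with n = S k.  It converges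
   absolutely for every real x, so [Series] never takes a junk value here. *)
Definition Cl2 (x : R) : R :=
  Series (fun k : nat => sin (INR (S k) * x) / INR (S k) ^ 2).

(* Main.v *)
(** For [0 <= th < pi/2] put [k = atan (sin th)].  Then
    [Cl2 th + Cl2 (pi - th) + Cl2 (2k - th) - Cl2 (pi - 2k - th)
     = Cl2 (2k) + Cl2 (pi - 2k) - Cl2 (pi - 4k) / 2]:
    both sides agree at [th = 0], and their derivatives agree because
    [Cl2' x = - ln (2 sin (x/2))] on ]0, pi[ and
    [sin (th/2) cos (k + th/2) = cos (th/2) sin (k - th/2)],
    [2 sin (k - th/2) * 2 cos (k + th/2) * 2 cos k = 2 sin k * 2 cos (2k)].
    The first relation says that [th] is a critical point of the left-hand side
    for fixed [k].  The theorem is the case [k = pi/6], combined with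
    [Cl2 (pi/3) = 3/2 Cl2 (2 pi/3)].  The other value of [alpha] modulo [2 pi] is
    [pi - asin (1 / sqrt 3)], and [alpha -> pi - alpha] preserves the left-hand side. *)

Require Import Defs.
From Stdlib Require Import Reals Ranalysis5 Lra Lia.
From Coquelicot Require Import Coquelicot.
Local Open Scope R_scope.

(** * Convergence and tail bounds for the Clausen series *)

Lemma is_derive_continuity_pt (f : R -> R) (x l : R) :
  is_derive f x l -> continuity_pt f x.
Proof.
intros H; apply derivable_continuous_pt; exists l; now apply is_derive_Reals.
Qed.

Lemma is_lim_seq_inv_INR : is_lim_seq (fun n => / INR (S n)) 0.
Proof.
apply (is_lim_seq_inv (fun n => INR (S n)) p_infty); try easy.
apply (is_lim_seq_incr_1 INR), is_lim_seq_INR.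
Qed.

Lemma inv_INR_eventually_lt (eps : R) :
  0 < eps -> exists N, forall n, (N <= n)%nat -> / INR (S n) < eps.
Proof.
intros Heps.
destruct (proj2 (is_lim_seq_spec _ _) is_lim_seq_inv_INR (mkposreal eps Heps)) as [N HN].
exists N; intros n Hn; specialize (HN n Hn); simpl in HN.
apply Rabs_def2 in HN; simpl; lra.
Qed.

Lemma is_series_inv_telescope (n : nat) :
  is_series (fun k => / INR (S (n + k)) - / INR (S (S (n + k)))) (/ INR (S n)).
Proof.
change (is_lim_seq (sum_n (fun k => / INR (S (n + k)) - / INR (S (S (n + k)))))
  (Finite (/ INR (S n)))).
apply is_lim_seq_ext with (fun m => / INR (S n) - / INR (S (S (n + m)))).
- intros m; rewrite sum_n_Reals; induction m as [|m IH].
  + simpl sum_f_R0; now rewrite Nat.add_0_r.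
  + change (sum_f_R0 ?a (S m)) with (sum_f_R0 a m + a (S m)); cbv beta.
    rewrite <- IH, Nat.add_succ_r; ring.
- replace (Finite (/ INR (S n))) with (Finite (/ INR (S n) - 0)) by (f_equal; ring).
  apply is_lim_seq_minus'; [apply is_lim_seq_const|].
  apply is_lim_seq_ext with (fun m => / INR (S (m + S n))).
  + intros m; do 3 f_equal; lia.
  + apply (is_lim_seq_incr_n (fun m => / INR (S m)) (S n)), is_lim_seq_inv_INR.
Qed.

(** With [c = INR (S m)], [1 / (c + 1)^2 <= 1 / (c (c + 1))], a telescoping majorant whose tails are
    explicit. The index starts at the second term of the series, because the first one would need
    [1 / 0]. *)
Lemma Cl2_term_bound (x : R) (m : nat) :
  Rabs (sin (INR (S (S m)) * x) / INR (S (S m)) ^ 2)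
  <= / INR (S m) - / INR (S (S m)).
Proof.
assert (H1 : 0 < INR (S m)) by (apply lt_0_INR; lia).
rewrite (S_INR (S m)); set (c := INR (S m)) in *.
unfold Rdiv; rewrite Rabs_mult, (Rabs_pos_eq (/ _)).
2: { apply Rlt_le, Rinv_0_lt_compat; nra. }
apply Rle_trans with (1 * / (c + 1) ^ 2).
- apply Rmult_le_compat_r; [apply Rlt_le, Rinv_0_lt_compat; nra|].
  apply Rabs_le, SIN_bound.
- replace (/ c - / (c + 1)) with (1 * / (c * (c + 1))) by (field; lra).
  apply Rmult_le_compat_l; [lra|]. apply Rinv_le_contravar; nra.
Qed.

Lemma ex_series_Cl2 (x : R) :
  ex_series (fun k => sin (INR (S k) * x) / INR (S k) ^ 2).
Proof.
apply ex_series_incr_1.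
refine (ex_series_le (V := R_CompleteNormedModule) _ _ _ (ex_intro _ _ (is_series_inv_telescope 0))).
intros n; apply Cl2_term_bound.
Qed.

(** The bound does not depend on [x], so the partial sums converge uniformly on the whole line. *)
Lemma Cl2_tail_bound (x : R) (n : nat) :
  Rabs (Cl2 x - sum_f_R0 (fun k => sin (INR (S k) * x) / INR (S k) ^ 2) n) <= / INR (S n).
Proof.
unfold Cl2; rewrite (Series_incr_n _ (S n)) by (try lia; apply ex_series_Cl2).
simpl Init.Nat.pred.
match goal with |- Rabs (?a + ?b - ?a) <= _ => replace (a + b - a) with b by ring end.
assert (Hb : forall k, 0 <=
  Rabs (sin (INR (S (S n + k)) * x) / INR (S (S n + k)) ^ 2)
  <= / INR (S (n + k)) - / INR (S (S (n + k)))).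
{ intros k; split; [apply Rabs_pos|apply Cl2_term_bound]. }
eapply Rle_trans; [apply Series_Rabs|].
- refine (ex_series_le (V := R_CompleteNormedModule) _ _ _ (ex_intro _ _ (is_series_inv_telescope n))).
  intros k; unfold norm; simpl norm; unfold abs; simpl abs; rewrite Rabs_Rabsolu; apply Hb.
- rewrite <- (is_series_unique _ _ (is_series_inv_telescope n)).
  apply Series_le; [exact Hb|eexists; apply is_series_inv_telescope].
Qed.

(** * Termwise derivatives of the partial sums, and continuity of [Cl2] *)

(** Each product [2 sin (x/2) sin (c x)] is a difference of cosines at [c - 1/2] and [c + 1/2], and
    these telescope. *)
Lemma Dirichlet_sin_sum (x : R) (n : nat) :
  2 * sin (x / 2) * sum_f_R0 (fun k => sin (INR (S k) * x)) n
  = cos (x / 2) - cos ((INR (S n) + 1 / 2) * x).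
Proof.
assert (H : forall c, 2 * sin (x / 2) * sin (c * x)
  = cos ((c - 1 / 2) * x) - cos ((c + 1 / 2) * x)).
{ intros c.
  replace ((c - 1 / 2) * x) with (c * x - x / 2) by field.
  replace ((c + 1 / 2) * x) with (c * x + x / 2) by field.
  rewrite cos_minus, cos_plus; ring. }
induction n as [|n IH].
- simpl sum_f_R0; rewrite H; simpl INR; do 2 f_equal; field.
- change (sum_f_R0 ?a (S n)) with (sum_f_R0 a n + a (S n)); cbv beta.
  rewrite Rmult_plus_distr_l, IH, H, (S_INR (S n)).
  replace (INR (S n) + 1 - 1 / 2) with (INR (S n) + 1 / 2) by field; ring.
Qed.

Lemma is_derive_cos_sum (x : R) (n : nat) :
  is_derive (fun y => sum_f_R0 (fun k => cos (INR (S k) * y) / INR (S k)) n) x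
    (- sum_f_R0 (fun k => sin (INR (S k) * x)) n).
Proof.
assert (Hk : forall k, is_derive (fun y => cos (INR (S k) * y) / INR (S k)) x
  (- sin (INR (S k) * x))).
{ intros k; auto_derive; [easy|].
  assert (INR (S k) <> 0) by (apply not_0_INR; lia).
  change (match k with O => 1 | S _ => INR k + 1 end) with (INR (S k)).
  field; auto. }
induction n as [|n IH]; [apply Hk|].
change (sum_f_R0 ?a (S n)) with (sum_f_R0 a n + a (S n)); cbv beta.
rewrite Ropp_plus_distr.
apply (is_derive_plus _ _ _ _ _ IH (Hk (S n))).
Qed.

Lemma is_derive_sin_sum (x : R) (n : nat) :
  is_derive (fun y => sum_f_R0 (fun k => sin (INR (S k) * y) / INR (S k) ^ 2) n) x
    (sum_f_R0 (fun k => cos (INR (S k) * x) / INR (S k)) n).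
Proof.
assert (Hk : forall k, is_derive (fun y => sin (INR (S k) * y) / INR (S k) ^ 2) x
  (cos (INR (S k) * x) / INR (S k))).
{ intros k.
  assert (INR (S k) <> 0) by (apply not_0_INR; lia).
  set (c := INR (S k)) in *.
  auto_derive; [easy|]. field; auto. }
induction n as [|n IH]; [apply Hk|].
apply (is_derive_plus _ _ _ _ _ IH (Hk (S n))).
Qed.

Lemma continuity_pt_Cl2 (x : R) : continuity_pt Cl2 x.
Proof.
apply (CVU_continuity
  (fun n y => sum_f_R0 (fun k => sin (INR (S k) * y) / INR (S k) ^ 2) n) Cl2 x
  (mkposreal 1 Rlt_0_1)).
- intros eps Heps; destruct (inv_INR_eventually_lt eps Heps) as [N HN].
  exists N; intros n y Hn _.
  apply Rle_lt_trans with (/ INR (S n)); [apply Cl2_tail_bound|now apply HN].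
- intros n y _.
  eapply is_derive_continuity_pt, is_derive_sin_sum.
- unfold Boule; simpl; rewrite Rminus_diag, Rabs_R0; lra.
Qed.

(** * Locally uniform convergence of the cosine series to [- ln (2 sin (x/2))], and the derivative
    of [Cl2] *)

(** This fixes the constant of integration for the cosine series, at [x = PI]. The Taylor remainder
    [f] of [ln (1 + t)] has derivative [(-t)^(n+1) / (1 + t)], at most [t^(n+1)] in absolute value
    for [t >= 0]; integrating over [[0, 1]] gives [1 / (n + 2)]. *)
Lemma alternating_harmonic_bound (n : nat) :
  Rabs (sum_f_R0 (fun k => cos (INR (S k) * PI) / INR (S k)) n + ln 2) <= / INR (S n).
Proof.
set (f := fun t => ln (1 + t) + sum_f_R0 (fun k => (- t) ^ S k / INR (S k)) n).
assert (Hs : forall t, is_derive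
  (fun t => sum_f_R0 (fun k => (- t) ^ S k / INR (S k)) n) t
  (- sum_f_R0 (fun k => (- t) ^ k) n)).
{ intros t.
  assert (Hk : forall k, is_derive (fun t => (- t) ^ S k / INR (S k)) t (- (- t) ^ k)).
  { intros k.
    assert (INR (S k) <> 0) by (apply not_0_INR; lia).
    auto_derive; [easy|].
    change (match k with O => 1 | S _ => INR k + 1 end) with (INR (S k)).
    field; auto. }
  clear f; induction n as [|m IH]; [apply Hk|].
  change (sum_f_R0 ?a (S m)) with (sum_f_R0 a m + a (S m)); cbv beta.
  rewrite Ropp_plus_distr.
  apply (is_derive_plus _ _ _ _ _ IH (Hk (S m))). }
assert (Hf : forall t, 0 <= t -> is_derive f t ((- t) ^ S n / (1 + t))).
{ intros t Ht.
  replace ((- t) ^ S n / (1 + t)) with (/ (1 + t) + - sum_f_R0 (fun k => (- t) ^ k) n).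
  2: { rewrite tech3 by lra. field. lra. }
  apply (is_derive_plus (fun t => ln (1 + t))); [|apply Hs].
  auto_derive; [lra|field; lra]. }
assert (Hp : forall t, is_derive (fun t => t ^ S (S n) / INR (S (S n))) t (t ^ S n)).
{ intros t.
  assert (INR (S (S n)) <> 0) by (apply not_0_INR; lia).
  auto_derive; [easy|].
  change (match n with O => 1 | S _ => INR n + 1 end + 1) with (INR (S (S n))).
  simpl Init.Nat.pred; simpl pow; field; auto. }
assert (Hb : forall t, 0 <= t -> Rabs ((- t) ^ S n / (1 + t)) <= t ^ S n).
{ intros t Ht; unfold Rdiv; rewrite Rabs_mult, <- RPow_abs, Rabs_Ropp, (Rabs_pos_eq t Ht).
  rewrite (Rabs_pos_eq (/ _)) by (apply Rlt_le, Rinv_0_lt_compat; lra).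
  rewrite <- (Rmult_1_r (t ^ S n)) at 2.
  apply Rmult_le_compat_l; [now apply pow_le|].
  rewrite <- Rinv_1 at 2; apply Rinv_le_contravar; lra. }
assert (f0 : f 0 = 0).
{ unfold f; rewrite Rplus_0_r, ln_1, Rplus_0_l.
  apply sum_eq_R0; intros k _; rewrite Ropp_0, pow_i by lia; apply Rmult_0_l. }
assert (f1 : f 1 = sum_f_R0 (fun k => cos (INR (S k) * PI) / INR (S k)) n + ln 2).
{ unfold f; replace (1 + 1) with 2 by ring; rewrite Rplus_comm; f_equal.
  apply sum_eq; intros k _; f_equal.
  generalize (S k) as m; induction m as [|m IH].
  - simpl; rewrite Rmult_0_l, cos_0; reflexivity.
  - rewrite S_INR, Rmult_plus_distr_r, Rmult_1_l, neg_cos, <- IH; simpl; ring. }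
rewrite <- f1.
(* The two signs give the two halves of the absolute value: [t^(n+2) / (n+2) - s * f t] vanishes at
   0 and has nonnegative derivative on [[0, 1]]. *)
assert (Hlim : forall s : R, s = 1 \/ s = -1 -> s * f 1 <= / INR (S (S n))).
{ intros s Hs1.
  assert (Hd : forall t, 0 <= t -> is_derive
    (fun t => t ^ S (S n) / INR (S (S n)) - s * f t) t
    (t ^ S n - s * ((- t) ^ S n / (1 + t)))).
  { intros t Ht; apply (is_derive_minus (K := R_AbsRing) (V := R_NormedModule)
      (fun t => t ^ S (S n) / INR (S (S n))) (fun t => s * f t) t _ _ (Hp t)).
    apply (is_derive_scal f t s), Hf, Ht. }
  destruct (MVT_gen _ 0 1 _ (fun t Ht => Hd t ltac:(rewrite Rmin_left in Ht by lra; lra))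
    (fun t Ht => is_derive_continuity_pt _ t _
      (Hd t ltac:(rewrite Rmin_left in Ht by lra; lra)))) as [c [Hc Heq]].
  - rewrite Rmin_left, Rmax_right in Hc by lra.
    rewrite f0, pow1, pow_i in Heq by lia.
    pose proof (Hb c (proj1 Hc)) as Hbc; apply Rabs_le_between in Hbc.
    unfold Rdiv in Heq at 1 2.
    destruct Hs1 as [-> | ->]; lra. }
apply Rle_trans with (/ INR (S (S n))).
- apply Rabs_le; split; [specialize (Hlim (-1))|specialize (Hlim 1)]; lra.
- apply Rinv_le_contravar; [apply lt_0_INR; lia|apply le_INR; lia].
Qed.

Lemma ln_2_sin_half_continuity (x : R) :
  0 < x < 2 * PI -> continuity_pt (fun y => - ln (2 * sin (y / 2))) x.
Proof.
intros Hx; assert (0 < sin (x / 2)) by (apply sin_gt_0; lra).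
apply is_derive_continuity_pt with (- (cos (x / 2) / (2 * sin (x / 2)))).
auto_derive; unfold Rdiv in *; [lra|field; lra].
Qed.

(* The sine term is, to leading order, the error of the cosine sum: with it
   subtracted, the derivative is O(1/n) instead of the O(1) of the Dirichlet kernel. *)
Lemma is_derive_cos_sum_error (x : R) (n : nat) :
  0 < x < 2 * PI ->
  is_derive (fun y => sum_f_R0 (fun k => cos (INR (S k) * y) / INR (S k)) n
      + ln (2 * sin (y / 2))
      - sin ((INR (S n) + 1 / 2) * y) / (2 * (INR (S n) + 1 / 2) * sin (y / 2)))
    x (sin ((INR (S n) + 1 / 2) * x) * cos (x / 2)
       / (4 * (INR (S n) + 1 / 2) * sin (x / 2) ^ 2)).
Proof.
intros Hx; assert (Hs : 0 < sin (x / 2)) by (apply sin_gt_0; lra).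
pose proof (Dirichlet_sin_sum x n) as HD.
pose proof (is_derive_cos_sum x n) as HC.
assert (HM : 0 < INR (S n)) by (apply lt_0_INR; lia).
set (M := INR (S n) + 1 / 2) in *; assert (0 < M) by (unfold M; lra).
(* The Dirichlet kernel term [cos (M x) / (2 sin (x/2))] cancels against the derivative of
   [sin (M x)] in the correction; only the derivative of [1 / sin (y/2)] survives, with its factor
   [1 / M]. *)
replace (sin (M * x) * cos (x / 2) / (4 * M * sin (x / 2) ^ 2)) with
  (- sum_f_R0 (fun k => sin (INR (S k) * x)) n
   + (cos (x / 2) / (2 * sin (x / 2))
      - (cos (M * x) / (2 * sin (x / 2))
         - sin (M * x) * cos (x / 2) / (4 * M * sin (x / 2) ^ 2)))).
- apply is_derive_ext with (fun y =>
    sum_f_R0 (fun k => cos (INR (S k) * y) / INR (S k)) n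
    + (ln (2 * sin (y / 2)) - sin (M * y) / (2 * M * sin (y / 2)))).
  { intros t; simpl; ring. }
  apply (is_derive_plus _ _ _ _ _ HC).
  auto_derive; unfold Rdiv in *.
  + repeat split; try lra. apply Rgt_not_eq; repeat apply Rmult_lt_0_compat; lra.
  + field; lra.
- replace (sum_f_R0 (fun k => sin (INR (S k) * x)) n) with
    ((cos (x / 2) - cos (M * x)) / (2 * sin (x / 2))) by (rewrite <- HD; field; lra).
  field; lra.
Qed.

Lemma Rabs_div_le (a b c : R) : 0 < c <= b -> Rabs a <= 1 -> Rabs (a / b) <= / c.
Proof.
intros Hc Ha; unfold Rdiv; rewrite Rabs_mult, (Rabs_pos_eq (/ b)).
2: { apply Rlt_le, Rinv_0_lt_compat; lra. }
rewrite <- (Rmult_1_l (/ c)).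
apply Rmult_le_compat; try apply Rabs_pos; try easy.
- apply Rlt_le, Rinv_0_lt_compat; lra.
- apply Rinv_le_contravar; lra.
Qed.

(** The mean value theorem carries the corrected error [G] from [PI], where it is controlled by the
    alternating harmonic series, down to [y]; then the correction is added back. Since [y] enters
    only through [m], the bound is uniform wherever [m] can be kept fixed. *)
Lemma cos_sum_error_bound (m y : R) (n : nat) :
  0 < m -> 0 < y <= PI -> (forall t, y <= t <= PI -> m <= sin (t / 2)) ->
  Rabs (sum_f_R0 (fun k => cos (INR (S k) * y) / INR (S k)) n + ln (2 * sin (y / 2)))
  <= 3 / m ^ 2 * / INR (S n).
Proof.
intros Hm Hy Hsin.
assert (Hc : 0 < INR (S n)) by (apply lt_0_INR; lia).
pose proof (fun t => is_derive_cos_sum_error t n) as HG.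
set (c := INR (S n)) in *; set (M := c + 1 / 2) in *.
assert (HM : c <= M) by (unfold M; lra).
set (C := sum_f_R0 (fun k => cos (INR (S k) * y) / INR (S k)) n).
set (G := fun y => sum_f_R0 (fun k => cos (INR (S k) * y) / INR (S k)) n
  + ln (2 * sin (y / 2)) - sin (M * y) / (2 * M * sin (y / 2))) in HG.
assert (Hm1 : m <= 1) by (rewrite <- sin_PI2; apply Hsin; lra).
assert (Hterm : forall t, y <= t <= PI ->
  Rabs (sin (M * t) / (2 * M * sin (t / 2))) <= / (2 * c * m)).
{ intros t Ht; specialize (Hsin t Ht).
  apply Rabs_div_le; [|apply Rabs_le, SIN_bound].
  split; [nra|]. apply Rmult_le_compat; nra. }
assert (HGPI : Rabs (G PI) <= / c + / (2 * c * m)).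
{ pose proof (alternating_harmonic_bound n) as Ha.
  replace (ln 2) with (ln (2 * sin (PI / 2))) in Ha
    by (rewrite sin_PI2; f_equal; ring).
  unfold G, Rminus.
  eapply Rle_trans; [apply Rabs_triang|]; rewrite Rabs_Ropp.
  apply Rplus_le_compat; [exact Ha|apply Hterm; lra]. }
assert (HGy : Rabs (G PI - G y) <= PI * / (4 * c * m ^ 2)).
{ assert (Hd : forall t, y <= t <= PI ->
    is_derive G t (sin (M * t) * cos (t / 2) / (4 * M * sin (t / 2) ^ 2))).
  { intros t Ht; apply HG; lra. }
  destruct (MVT_gen G y PI
    (fun t => sin (M * t) * cos (t / 2) / (4 * M * sin (t / 2) ^ 2)))
    as [t [Ht Heq]].
  - intros t; rewrite Rmin_left, Rmax_right by lra; intros Ht; apply Hd; lra.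
  - intros t; rewrite Rmin_left, Rmax_right by lra; intros Ht.
    eapply is_derive_continuity_pt, Hd; lra.
  - rewrite Rmin_left, Rmax_right in Ht by lra; rewrite Heq, Rabs_mult, Rmult_comm.
    specialize (Hsin t Ht).
    apply Rmult_le_compat; try apply Rabs_pos.
    + rewrite Rabs_pos_eq; lra.
    + apply Rabs_div_le.
      * assert (m ^ 2 <= sin (t / 2) ^ 2) by (apply pow_incr; lra).
        assert (0 < m ^ 2) by (apply pow_lt; lra).
        split; [nra|]. apply Rmult_le_compat; nra.
      * rewrite Rabs_mult, <- (Rmult_1_r 1).
        apply Rmult_le_compat; try apply Rabs_pos; apply Rabs_le;
          [apply SIN_bound|apply COS_bound]. }
replace (C + ln (2 * sin (y / 2))) with
  (- (G PI - G y) + (G PI + sin (M * y) / (2 * M * sin (y / 2)))) by (unfold G, C; ring).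
eapply Rle_trans; [apply Rabs_triang|]; rewrite Rabs_Ropp.
assert (H2 := Rabs_triang (G PI) (sin (M * y) / (2 * M * sin (y / 2)))).
assert (H3 := Hterm y (conj (Rle_refl y) (proj2 Hy))).
(* In units of [1 / (c m^2)], using [1 <= 1 / m], the contributions are [1 + 1/2] for [G PI], [1/2]
   for the correction at [y], and [PI / 4 <= 1] for the variation of [G]: in total 3. *)
assert (Hu : 1 <= / m) by (rewrite <- Rinv_1; apply Rinv_le_contravar; lra).
assert (Hv : 0 < / c) by (now apply Rinv_0_lt_compat).
replace (/ (2 * c * m)) with (/ 2 * / c * / m) in * by (field; lra).
replace (/ (4 * c * m ^ 2)) with (/ 4 * / c * (/ m * / m)) in * by (field; lra).
replace (3 / m ^ 2 * / c) with (3 * / c * (/ m * / m)) by (field; lra).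
assert (Hu2 : / m <= / m * / m) by nra.
assert (/ c * / m <= / c * (/ m * / m)) by (apply Rmult_le_compat_l; lra).
assert (/ c * 1 <= / c * (/ m * / m)) by (apply Rmult_le_compat_l; lra).
assert (PI * (/ 4 * / c * (/ m * / m)) <= 4 * (/ 4 * / c * (/ m * / m))).
{ apply Rmult_le_compat_r; [|apply PI_4].
  repeat apply Rmult_le_pos; lra. }
lra.
Qed.

Lemma is_derive_Cl2 (x : R) :
  0 < x < PI -> is_derive Cl2 x (- ln (2 * sin (x / 2))).
Proof.
intros Hx; apply is_derive_Reals.
(* The ball of this radius stays in []x/2, PI[], where [sin (t/2) >= sin (x/4)]; hence the choice of
   [m] below. *)
assert (Hr : 0 < Rmin (x / 2) (PI - x)) by (apply Rmin_glb_lt; lra).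
set (r := mkposreal _ Hr).
assert (Hball : forall y, Boule x r y -> x / 2 < y < PI).
{ intros y Hy; unfold Boule, r in Hy; simpl in Hy; apply Rabs_def2 in Hy.
  pose proof (Rmin_l (x / 2) (PI - x)); pose proof (Rmin_r (x / 2) (PI - x)); lra. }
set (m := sin (x / 4)).
assert (Hm : 0 < m) by (apply sin_gt_0; lra).
apply (derivable_pt_lim_CVU
  (fun n y => sum_f_R0 (fun k => sin (INR (S k) * y) / INR (S k) ^ 2) n)
  (fun n y => sum_f_R0 (fun k => cos (INR (S k) * y) / INR (S k)) n)
  Cl2 (fun y => - ln (2 * sin (y / 2))) x x r).
- unfold Boule; rewrite Rminus_diag, Rabs_R0; apply cond_pos.
- intros y n _; apply is_derive_Reals, is_derive_sin_sum.
- intros y _ eps Heps; destruct (inv_INR_eventually_lt eps Heps) as [N HN].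
  exists N; intros n Hn; unfold Rdist; rewrite Rabs_minus_sym.
  apply Rle_lt_trans with (/ INR (S n)); [apply Cl2_tail_bound|now apply HN].
- intros eps Heps.
  assert (H3 : 0 < 3 / m ^ 2) by (apply Rdiv_lt_0_compat; [lra|now apply pow_lt]).
  destruct (inv_INR_eventually_lt (eps / (3 / m ^ 2))) as [N HN].
  { now apply Rdiv_lt_0_compat. }
  exists N; intros n y Hn Hy; apply Hball in Hy.
  rewrite Rabs_minus_sym; unfold Rminus; rewrite Ropp_involutive.
  apply Rle_lt_trans with (3 / m ^ 2 * / INR (S n)).
  + apply cos_sum_error_bound; try lra.
    intros t Ht; apply sin_incr_1; lra.
  + apply Rlt_le_trans with (3 / m ^ 2 * (eps / (3 / m ^ 2))).
    * apply Rmult_lt_compat_l; auto.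
    * right; field; lra.
- intros y Hy; apply Hball in Hy; apply ln_2_sin_half_continuity; lra.
Qed.

(** * Symmetries, special values and the duplication formula *)

(** This is periodicity modulo [2 PI] with no explicit multiple of the period: sine and cosine of
    [x] determine those of every [n x] by the addition formulas. *)
Lemma Cl2_congr (x y : R) : sin x = sin y -> cos x = cos y -> Cl2 x = Cl2 y.
Proof.
intros Hs Hc; apply Series_ext; intros k; f_equal.
enough (H : forall n, sin (INR n * x) = sin (INR n * y) /\ cos (INR n * x) = cos (INR n * y))
  by apply H.
intros n; induction n as [|n [IHs IHc]]; [simpl; now rewrite !Rmult_0_l|].
rewrite S_INR, !Rmult_plus_distr_r, !Rmult_1_l, !sin_plus, !cos_plus, IHs, IHc, Hs, Hc; auto.
Qed.

Lemma Cl2_opp (x : R) : Cl2 (- x) = - Cl2 x.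
Proof.
unfold Cl2; rewrite <- Series_opp; apply Series_ext; intros k.
rewrite Ropp_mult_distr_r_reverse, sin_neg; unfold Rdiv; ring.
Qed.

Lemma Cl2_0 : Cl2 0 = 0.
Proof. assert (H := Cl2_opp 0); rewrite Ropp_0 in H; lra. Qed.

Lemma Cl2_PI : Cl2 PI = 0.
Proof.
assert (H : Cl2 PI = Cl2 (- PI)).
{ apply Cl2_congr; [rewrite sin_neg, sin_PI; ring|now rewrite cos_neg]. }
rewrite Cl2_opp in H; lra.
Qed.

(** At the endpoints only continuity is asked for, since the derivative of [Cl2] blows up at 0. *)
Lemma eq_of_derive_0 (f : R -> R) (a b : R) :
  a <= b -> (forall x, a < x < b -> is_derive f x 0) ->
  (forall x, a <= x <= b -> continuity_pt f x) -> f b = f a.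
Proof.
intros Hab Hd Hc.
destruct (MVT_gen f a b (fun _ => 0)) as [c [_ H]];
  rewrite ?Rmin_left, ?Rmax_right by lra; auto; lra.
Qed.

Lemma continuity_pt_Cl2_comp (g : R -> R) (x : R) :
  continuity_pt g x -> continuity_pt (fun y => Cl2 (g y)) x.
Proof. intros Hg; apply (continuity_pt_comp g Cl2); [easy|apply continuity_pt_Cl2]. Qed.

Lemma is_derive_Cl2_comp (g : R -> R) (x dg : R) :
  0 < g x < PI -> is_derive g x dg ->
  is_derive (fun y => Cl2 (g y)) x (dg * - ln (2 * sin (g x / 2))).
Proof. intros Hx Hg; apply (is_derive_comp Cl2 g); [now apply is_derive_Cl2|easy]. Qed.

Lemma sin_double_half (x : R) : sin x = 2 * sin (x / 2) * cos (x / 2).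
Proof. rewrite <- sin_2a; f_equal; field. Qed.

(** Both sides vanish at 0, and their derivatives agree by the logarithm of
    [2 sin t = 2 sin (t/2) * 2 cos (t/2)]. The range of [x] keeps all arguments in [[0, PI]]. *)
Lemma Cl2_duplication (x : R) :
  0 <= x <= PI / 2 -> Cl2 (2 * x) = 2 * Cl2 x - 2 * Cl2 (PI - x).
Proof.
intros Hx.
enough (H : Cl2 (2 * x) - 2 * Cl2 x + 2 * Cl2 (PI - x) =
  Cl2 (2 * 0) - 2 * Cl2 0 + 2 * Cl2 (PI - 0)).
{ rewrite Rmult_0_r, Rminus_0_r, Cl2_0, Cl2_PI in H; lra. }
apply (eq_of_derive_0 (fun y => Cl2 (2 * y) - 2 * Cl2 y + 2 * Cl2 (PI - y))).
- easy.
- intros t Ht.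
  assert (0 < sin (t / 2)) by (apply sin_gt_0; lra).
  assert (0 < cos (t / 2)) by (apply cos_gt_0; lra).
  assert (H1 : is_derive (fun y => Cl2 (2 * y)) t (2 * - ln (2 * sin (2 * t / 2)))).
  { apply is_derive_Cl2_comp; [lra|]. auto_derive; [easy|ring]. }
  assert (H2 := is_derive_Cl2 t ltac:(lra)).
  assert (H3 : is_derive (fun y => Cl2 (PI - y)) t (-1 * - ln (2 * sin ((PI - t) / 2)))).
  { apply is_derive_Cl2_comp; [lra|]. auto_derive; [easy|ring]. }
  replace (2 * t / 2) with t in H1 by field.
  replace ((PI - t) / 2) with (PI / 2 - t / 2) in H3 by field.
  rewrite sin_shift in H3.
  assert (Hln : ln (2 * sin t) = ln (2 * sin (t / 2)) + ln (2 * cos (t / 2))).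
  { rewrite <- ln_mult by lra; f_equal; rewrite (sin_double_half t); ring. }
  rewrite Hln in H1.
  evar_last.
  + apply @is_derive_plus; [apply @is_derive_minus|]; [exact H1| |].
    * apply is_derive_scal, H2.
    * apply is_derive_scal, H3.
  + change (2 * - (ln (2 * sin (t / 2)) + ln (2 * cos (t / 2)))
      - 2 * - ln (2 * sin (t / 2)) + 2 * (-1 * - ln (2 * cos (t / 2))) = 0); ring.
- intros t _.
  apply continuity_pt_plus; [apply continuity_pt_minus|].
  + apply continuity_pt_Cl2_comp; reg.
  + apply continuity_pt_scal, continuity_pt_Cl2.
  + apply (continuity_pt_scal (fun y => Cl2 (PI - y))), continuity_pt_Cl2_comp; reg.
Qed.

(** * The four-term relation *)

Lemma Cl2_four_term (th : R) :
  0 <= th < PI / 2 ->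
  let k := atan (sin th) in
  Cl2 th + Cl2 (PI - th) + Cl2 (2 * k - th) - Cl2 (PI - 2 * k - th)
  = Cl2 (2 * k) + Cl2 (PI - 2 * k) - / 2 * Cl2 (PI - 4 * k).
Proof.
intros Hth; cbv zeta.
(* Difference of the two sides, with [k] varying along with [t]. At 0 every argument is 0 or [PI],
   so every term vanishes. *)
set (H := fun t => Cl2 t + (Cl2 (PI - t) + (Cl2 (2 * atan (sin t) - t)
  + (-1 * Cl2 (PI - 2 * atan (sin t) - t) + (-1 * Cl2 (2 * atan (sin t))
  + (-1 * Cl2 (PI - 2 * atan (sin t)) + / 2 * Cl2 (PI - 4 * atan (sin t)))))))).
enough (Heq : H th = H 0).
{ unfold H in Heq; rewrite sin_0, atan_0, !Rmult_0_r, !Rminus_0_r, Cl2_0, Cl2_PI in Heq; lra. }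
(* All arguments of [Cl2] are of the form [a + b k + c t]. The derivative [dk] of [k] stays
   abstract: in [H'] its coefficient vanishes by [E2] below, and the remaining part by [E1]. *)
assert (Hatan : forall t, exists dk, forall a b c,
  is_derive (fun t => a + b * atan (sin t) + c * t) t (b * dk + c)).
{ intros t; exists (/ (1 + (sin t)²) * cos t); intros a b c.
  assert (Hdk : is_derive (fun t => atan (sin t)) t (/ (1 + (sin t)²) * cos t)).
  { apply is_derive_Reals.
    apply (derivable_pt_lim_comp sin atan); [apply derivable_pt_lim_sin|].
    apply is_derive_Reals, is_derive_atan. }
  evar_last.
  - apply @is_derive_plus; [apply @is_derive_plus|];
      [apply is_derive_const|apply is_derive_scal, Hdk|apply is_derive_scal, is_derive_id].
  - match goal with |- _ = ?y => change (0 + b * (/ (1 + (sin t)²) * cos t) + c * 1 = y) end; ring. }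
apply eq_of_derive_0; [easy| |].
- intros t Ht.
  set (k := atan (sin t)).
  destruct (Hatan t) as [dk Hlin].
  assert (Hs : 0 < sin t < 1).
  { split; [apply sin_gt_0; lra|]. rewrite <- sin_PI2; apply sin_increasing_1; lra. }
  assert (Hk : 0 < k < PI / 4).
  { unfold k; rewrite <- atan_0, <- atan_1; split; apply atan_increasing; lra. }
  assert (Htan : sin t * cos k = sin k).
  { rewrite <- (tan_atan (sin t)) at 1; fold k; unfold tan; field.
    apply Rgt_not_eq, cos_gt_0; lra. }
  assert (Hck : 0 < cos k) by (apply cos_gt_0; lra).
  assert (Hsk : 0 < sin k) by (apply sin_gt_0; lra).
  assert (Hc2k : 0 < cos (2 * k)) by (apply cos_gt_0; lra).
  (* This keeps [2 k - t] in []0, PI[]. It holds because [sin (2 k) = 2 sin t (cos k)^2] and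
     [cos (2 k) > 0] means [2 (cos k)^2 > 1]. *)
  assert (Htk : t < 2 * k).
  { apply sin_increasing_0; try lra.
    rewrite sin_2a; rewrite cos_2a_cos in Hc2k.
    apply Rmult_lt_reg_r with (cos k); [easy|]; rewrite Htan; nra. }
  assert (Hst : 0 < sin (t / 2)) by (apply sin_gt_0; lra).
  assert (Hct : 0 < cos (t / 2)) by (apply cos_gt_0; lra).
  assert (Hskt : 0 < sin (k - t / 2)) by (apply sin_gt_0; lra).
  assert (Hckt : 0 < cos (k + t / 2)) by (apply cos_gt_0; lra).
  pose proof (sin_double_half t) as Hdh.
  (* Expanded by the addition formulas, this is [sin t * cos k = sin k], the definition of [k]. *)
  assert (E1 : ln (2 * sin (t / 2)) + ln (2 * cos (k + t / 2))
    = ln (2 * cos (t / 2)) + ln (2 * sin (k - t / 2))).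
  { rewrite <- !ln_mult by lra; f_equal.
    pose proof (sin2_cos2 (t / 2)) as Hp; unfold Rsqr in Hp.
    assert (Hp' : sin k = 2 * sin (t / 2) * cos (t / 2) * cos k) by (rewrite <- Hdh; auto).
    rewrite sin_minus, cos_plus.
    apply Rminus_diag_uniq.
    transitivity (4 * (2 * sin (t / 2) * cos (t / 2) * cos k
      - sin k * (sin (t / 2) * sin (t / 2) + cos (t / 2) * cos (t / 2)))); [ring|].
    rewrite Hp, Hp' at 1; ring. }
  (* Here [2 sin (k - t/2) cos (k + t/2) = sin (2 k) - sin t]; multiplying by [cos k] turns [sin t]
     into [sin k], leaving [sin k (2 (cos k)^2 - 1)]. *)
  assert (E2 : ln (2 * sin (k - t / 2)) + ln (2 * cos (k + t / 2)) + ln (2 * cos k)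
    = ln (2 * sin k) + ln (2 * cos (2 * k))).
  { rewrite <- !ln_mult by (try apply Rmult_lt_0_compat; lra); f_equal.
    replace (2 * sin (k - t / 2) * (2 * cos (k + t / 2))) with (2 * (sin (2 * k) - sin t)).
    - rewrite sin_2a, cos_2a_cos, <- Htan; ring.
    - replace (2 * k) with ((k - t / 2) + (k + t / 2)) by field.
      replace (sin t) with (sin ((k + t / 2) - (k - t / 2))) by (f_equal; field).
      rewrite (sin_plus (k - t / 2)), (sin_minus (k + t / 2)); ring. }
  assert (Hterm : forall a b c u, 0 < u < PI -> u = a + b * k + c * t ->
    forall g, (forall t, g t = a + b * atan (sin t) + c * t) ->
    is_derive (fun t => Cl2 (g t)) t ((b * dk + c) * - ln (2 * sin (u / 2)))).
  { intros a b c u Hu Hua g Hg.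
    assert (Hgt : g t = u) by (rewrite Hg, Hua; reflexivity).
    rewrite <- Hgt; apply is_derive_Cl2_comp; [now rewrite Hgt|].
    apply (is_derive_ext (fun t => a + b * atan (sin t) + c * t)); [intros; now rewrite Hg|].
    apply Hlin. }
  evar_last.
  + unfold H.
    apply @is_derive_plus; [|apply @is_derive_plus; [|apply @is_derive_plus; [|
      apply @is_derive_plus; [|apply @is_derive_plus; [|apply @is_derive_plus]]]]].
    * apply (Hterm 0 0 1 t); [lra|ring|intros; ring].
    * apply (Hterm PI 0 (-1) (PI - t)); [lra|ring|intros; ring].
    * apply (Hterm 0 2 (-1) (2 * k - t)); [lra|ring|intros; ring].
    * apply is_derive_scal, (Hterm PI (-2) (-1) (PI - 2 * k - t)); [lra|ring|intros; ring].
    * apply is_derive_scal, (Hterm 0 2 0 (2 * k)); [lra|ring|intros; ring].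
    * apply is_derive_scal, (Hterm PI (-2) 0 (PI - 2 * k)); [lra|ring|intros; ring].
    * apply is_derive_scal, (Hterm PI (-4) 0 (PI - 4 * k)); [lra|ring|intros; ring].
  + unfold plus; simpl.
    match goal with |- @eq _ ?x ?y => change (@eq R x y) end.
    replace ((PI - t) / 2) with (PI / 2 - t / 2) by field.
    replace ((2 * k - t) / 2) with (k - t / 2) by field.
    replace ((PI - 2 * k - t) / 2) with (PI / 2 - (k + t / 2)) by field.
    replace (2 * k / 2) with k by field.
    replace ((PI - 2 * k) / 2) with (PI / 2 - k) by field.
    replace ((PI - 4 * k) / 2) with (PI / 2 - 2 * k) by field.
    rewrite !sin_shift.
    replace (ln (2 * cos (2 * k))) with (ln (2 * sin (k - t / 2)) + ln (2 * cos (k + t / 2))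
      + ln (2 * cos k) - ln (2 * sin k)) by lra.
    replace (ln (2 * cos (t / 2))) with (ln (2 * sin (t / 2)) + ln (2 * cos (k + t / 2))
      - ln (2 * sin (k - t / 2))) by lra.
    field.
- intros t _; unfold H.
  destruct (Hatan t) as [dk Hlin].
  assert (Hg : forall a b c g, (forall t, g t = a + b * atan (sin t) + c * t) ->
    continuity_pt (fun t => Cl2 (g t)) t).
  { intros a b c g Hgt; apply continuity_pt_Cl2_comp.
    apply (continuity_pt_ext (fun t => a + b * atan (sin t) + c * t)); [intros; now rewrite Hgt|].
    eapply is_derive_continuity_pt, Hlin. }
  repeat apply continuity_pt_plus.
  + apply continuity_pt_Cl2.
  + apply (Hg PI 0 (-1)); intros; ring.
  + apply (Hg 0 2 (-1)); intros; ring.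
  + apply continuity_pt_scal, (Hg PI (-2) (-1)); intros; ring.
  + apply continuity_pt_scal, (Hg 0 2 0); intros; ring.
  + apply continuity_pt_scal, (Hg PI (-2) 0); intros; ring.
  + apply continuity_pt_scal, (Hg PI (-4) 0); intros; ring.
Qed.

(** * The case [k = PI / 6], and reduction of a general [alpha] to it *)

Lemma Cl2_identity_acute (a : R) :
  0 <= a < PI / 2 -> sin a = 1 / sqrt 3 ->
  Cl2 a + Cl2 (PI - a) + Cl2 (PI / 3 - a) - Cl2 (2 * PI / 3 - a)
  = 7 / 4 * Cl2 (2 * PI / 3).
Proof.
intros Ha Hs.
assert (H := Cl2_four_term a Ha); cbv zeta in H.
rewrite Hs, <- tan_PI6, atan_tan in H by (pose proof PI_RGT_0; lra).
replace (2 * (PI / 6)) with (PI / 3) in H by field.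
replace (PI - PI / 3) with (2 * PI / 3) in H by field.
replace (PI - 4 * (PI / 6)) with (PI / 3) in H by field.
(* Since [2 k = PI - 4 k = PI / 3], the right-hand side is [Cl2 (PI/3) / 2 + Cl2 (2 PI/3)].
   Duplication at [PI / 3] gives [Cl2 (PI/3) = 3/2 Cl2 (2 PI/3)], whence [3/4 + 1 = 7/4]. *)
assert (H2 := Cl2_duplication (PI / 3) ltac:(pose proof PI_RGT_0; lra)).
replace (PI - PI / 3) with (2 * PI / 3) in H2 by field.
replace (2 * (PI / 3)) with (2 * PI / 3) in H2 by field.
lra.
Qed.

Theorem mainTheorem2 (alpha : R) (halpha : sin alpha = 1 / sqrt 3) :
  Cl2 alpha + Cl2 (PI - alpha) + Cl2 (PI / 3 - alpha) - Cl2 (2 * PI / 3 - alpha)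
  = 7 / 4 * Cl2 (2 * PI / 3).
Proof.
assert (H3 : 0 < / sqrt 3 < 1).
{ assert (1 < sqrt 3) by (rewrite <- sqrt_1; apply sqrt_lt_1; lra).
  split; [apply Rinv_0_lt_compat; lra|].
  rewrite <- Rinv_1; apply Rinv_lt_contravar; lra. }
set (a := asin (1 / sqrt 3)).
assert (Hsa : sin a = 1 / sqrt 3) by (apply sin_asin; lra).
assert (Ha : 0 <= a < PI / 2).
{ pose proof (asin_bound (1 / sqrt 3)) as Hb; fold a in Hb.
  split.
  - apply Rnot_lt_le; intros Hn.
    assert (sin a < 0) by (apply sin_lt_0_var; lra). lra.
  - destruct (Req_dec a (PI / 2)) as [He|He]; [|lra].
    rewrite He, sin_PI2 in Hsa; lra. }
rewrite <- (Cl2_identity_acute a Ha Hsa).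
assert (Hs : sin alpha = sin a) by congruence.
assert (Hc : cos alpha = cos a \/ cos alpha = - cos a).
{ apply Rsqr_eq; rewrite !cos2, Hs; reflexivity. }
assert (Hsub : forall x b, sin alpha = sin x -> cos alpha = cos x ->
  Cl2 (b - alpha) = Cl2 (b - x)).
{ intros x b Hsx Hcx; apply Cl2_congr; rewrite ?sin_minus, ?cos_minus, Hsx, Hcx; reflexivity. }
destruct Hc as [Hc|Hc].
- rewrite !(Hsub a), (Cl2_congr alpha a) by easy; reflexivity.
(* Here [alpha] is [PI - a] modulo [2 PI]. The first two terms are exchanged; the last two are
   exchanged as well, their signs being restored by oddness. *)
- rewrite <- Rtrigo_facts.cos_pi_minus in Hc; rewrite <- (sin_PI_x a) in Hs.
  rewrite !(Hsub (PI - a)), (Cl2_congr alpha (PI - a)) by easy.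
  replace (PI - (PI - a)) with a by ring.
  replace (PI / 3 - (PI - a)) with (- (2 * PI / 3 - a)) by field.
  replace (2 * PI / 3 - (PI - a)) with (- (PI / 3 - a)) by field.
  rewrite !Cl2_opp; ring.
Qed.
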